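(* Let $\mathrm r=(r_1,\dots,r_d)\in\mathbb{Z}_+^d$ with $\mathrm r>0$. Then the map $\Phi:\mathcal F_d^{\mathrm r}\to S_d^{\mathrm r}\times C_d^{\mathrm r}$, $(\mathbf f,c_{\mathbf f})\mapsto(\Psi((\mathbf f,c_{\mathbf f})),\mathrm c_{(\mathbf f,c_{\mathbf f})})$, is a bijection.
   Context: $d\ge2$, $[d]=\{1,\dots,d\}$. A plane forest is a finite or infinite sequence $\mathbf t_1,\mathbf t_2,\dots$ of finite rooted plane (ordered) trees; its vertices are listed in breadth-first search order (first the vertices of $\mathbf t_1$ generation by generation, each generation from left to right, then those of $\mathbf t_2$, etc.). A $d$-type forest $(\mathbf f,c_{\mathbf f})$ is a plane forest with a map $c_{\mathbf f}$ from its vertices to $[d]$ (the type) such that children of a common parent appear, from left to right, in nondecreasing order of type; $\mathcal F_d$ is the set of (unlabeled) $d$-type forests. $p_j(u)$ is the number of children of type $j$ of vertex $u$. A subtree of type $i$ is a maximal connected subgraph all of whose vertices have type $i$; the subforest $\mathbf f^{(i)}$ of type $i$ is the plane forest formed by the subtrees of type $i$ ranked according to the order of their roots in $\mathbf f$; $u^{(i)}_1,u^{(i)}_2,\dots$ are its vertices in its own breadth-first order. The root type sequence is $\mathrm c_{(\mathbf f,c_{\mathbf f})}=(c_{\mathbf f}(r(\mathbf t_1)),c_{\mathbf f}(r(\mathbf t_2)),\dots)$, $r(\mathbf t)$ the root of $\mathbf t$. $S_d$: families $x=(x^{(1)},\dots,x^{(d)})$, $x^{(i)}=(x^{i,1},\dots,x^{i,d})$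 a $\mathbb{Z}^d$-valued sequence indexed by $\{0,\dots,n_i\}$ ($0\le n_i\le\infty$), $x^{(i)}_0=0$, $x^{i,j}$ nondecreasing for $i\ne j$, $x^{i,i}_{n+1}-x^{i,i}_n\ge -1$; $(n_1,\dots,n_d)$ is its length; $x^{i,j}(n):=x^{i,j}_n$. $\Psi:\mathcal F_d\to S_d$ maps $(\mathbf f,c_{\mathbf f})$ to $x$ where $n_i$ is the number of vertices of $\mathbf f^{(i)}$, $x^{(i)}_0=0$, $x^{i,j}_{n+1}-x^{i,j}_n=p_j(u^{(i)}_{n+1})$ for $j\ne i$ and $x^{i,i}_{n+1}-x^{i,i}_n=p_i(u^{(i)}_{n+1})-1$, $0\le n\le n_i-1$. Coordinatewise order $\le$; $\mathrm q<\mathrm q'$ means $\mathrm q\le\mathrm q'$ and $\mathrm q\ne\mathrm q'$. A solution of $(\mathrm r,x)$ (for $x$ of length $\mathrm q$) is $\mathrm s\in\mathbb{Z}_+^d$, $\mathrm s\le\mathrm q$, with $r_j+\sum_ix^{i,j}(s_i)=0$ for all $j$; the smallest solution is a solution $\le$ every solution. $S_d^{\mathrm r}$ is the set of $x\in S_d$ whose length lies in $\mathbb{N}^d$ ($\mathbb N=\{1,2,\dots\}$) and is the smallest solution of $(\mathrm r,x)$. For $r=r_1+\dots+r_d$, $C_d^{\mathrm r}=\{c\in[d]^r:\#\{j\in[r]:c_j=i\}=r_i,\ i\in[d]\}$. $\mathcal F_d^{\mathrm r}$ is the set of $(\mathbf f,c_{\mathbf f})\in\mathcal F_d$ having $r_1+\dots+r_d$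 trees, containing at least one vertex of each type, and with root type sequence in $C_d^{\mathrm r}$. *)

(* Defs.v *)
From mathcomp Require Import all_boot all_order all_algebra.
Set Implicit Arguments. Unset Strict Implicit. Unset Printing Implicit Defensive.
Import GRing.Theory Num.Theory.

(* Types [d] = {1,..,d} are represented by 'I_d = {0,..,d-1} (type i <-> ordinal i-1). *)

Inductive mtree (d : nat) : Type := MNode of 'I_d & seq (mtree d).

Definition mlabel d (t : mtree d) : 'I_d := let: MNode i _ := t in i.
Definition mkids d (t : mtree d) : seq (mtree d) := let: MNode _ cs := t in cs.

Fixpoint msize d (t : mtree d) : nat :=
  let: MNode _ cs := t in (sumn (map (@msize d) cs)).+1.

Fixpoint mwf d (t : mtree d) : bool :=
  let: MNode _ cs := t in
  sorted leq (map (fun c => nat_of_ord (mlabel c)) cs) && all (@mwf d) cs.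

(* breadth-first search of a tree, generation by generation; each vertex
   (represented by the subtree it roots) is flagged with whether it is the
   root of a monochromatic subtree (root of the tree, or type differs from parent) *)
Definition next_gen d (g : seq (mtree d * bool)) : seq (mtree d * bool) :=
  flatten [seq [seq (c, mlabel c != mlabel w.1) | c <- mkids w.1] | w <- g].
Definition tree_bfs d (t : mtree d) : seq (mtree d * bool) :=
  flatten [seq iter k (@next_gen d) [:: (t, true)] | k <- iota 0 (msize t)].
Definition forest_bfs d (f : seq (mtree d)) : seq (mtree d * bool) :=
  flatten (map (@tree_bfs d) f).

Definition next_mgen d (i : 'I_d) (g : seq (mtree d)) : seq (mtree d) :=
  flatten [seq [seq c <- mkids w | mlabel c == i] | w <- g].
Definition mono_bfs d (v : mtree d) : seq (mtree d) :=
  flatten [seq iter k (next_mgen (mlabel v)) [:: v] | k <- iota 0 (msize v)].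

Definition subforest_vertices d (f : seq (mtree d)) (i : 'I_d) : seq (mtree d) :=
  flatten [seq mono_bfs w.1 | w <- forest_bfs f & w.2 && (mlabel w.1 == i)].

Definition pchildren d (u : mtree d) (j : 'I_d) : nat :=
  count (fun c => mlabel c == j) (mkids u).

Local Open Scope ring_scope.

(* A family x = (x^(1),...,x^(d)) of finite Z^d-valued sequences:
   x i = [:: x^(i)_0; ...; x^(i)_{n_i}]. *)
Definition seqfam (d : nat) := {ffun 'I_d -> seq {ffun 'I_d -> int}}.

Definition xlen d (x : seqfam d) (i : 'I_d) : nat := (size (x i)).-1.
Definition xval d (x : seqfam d) (i : 'I_d) (n : nat) (j : 'I_d) : int :=
  nth [ffun => 0] (x i) n j.

Definition in_Sd d (x : seqfam d) : Prop :=
  forall i : 'I_d,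
    (0 < size (x i))%N /\ (forall j, xval x i 0 j = 0) /\
    (forall n, (n < xlen x i)%N -> forall j : 'I_d,
        (j != i -> xval x i n j <= xval x i n.+1 j) /\
        (j = i -> -1 <= xval x i n.+1 i - xval x i n i)).

Definition is_solution d (r : 'I_d -> nat) (x : seqfam d) (s : 'I_d -> nat) : Prop :=
  (forall i, s i <= xlen x i)%N /\
  (forall j : 'I_d, (r j)%:Z + \sum_(i < d) xval x i (s i) j = 0).

Definition is_smallest_solution d (r : 'I_d -> nat) (x : seqfam d) (q : 'I_d -> nat) : Prop :=
  is_solution r x q /\ (forall s, is_solution r x s -> forall i, q i <= s i)%N.

Definition in_Sdr d (r : 'I_d -> nat) (x : seqfam d) : Prop :=
  in_Sd x /\ (forall i, 0 < xlen x i)%N /\ is_smallest_solution r x (xlen x).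

Definition in_Cdr d (r : 'I_d -> nat) (c : seq 'I_d) : Prop :=
  size c = (\sum_(i < d) r i)%N /\ (forall i : 'I_d, count_mem i c = r i).

Definition root_types d (f : seq (mtree d)) : seq 'I_d := map (@mlabel d) f.

Definition in_Fdr d (r : 'I_d -> nat) (f : seq (mtree d)) : Prop :=
  all (@mwf d) f /\ size f = (\sum_(i < d) r i)%N /\
  (forall i : 'I_d, has (fun w => mlabel w.1 == i) (forest_bfs f)) /\
  in_Cdr r (root_types f).

Definition psi_inc d (i : 'I_d) (u : mtree d) : {ffun 'I_d -> int} :=
  [ffun j => (pchildren u j)%:Z - (nat_of_bool (j == i))%:Z].

Definition Psi d (f : seq (mtree d)) : seqfam d :=
  [ffun i => let us := subforest_vertices f i in
     [seq [ffun j => \sum_(u <- take n us) psi_inc i u j] | n <- iota 0 (size us).+1]].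

Definition Phi d (f : seq (mtree d)) : seqfam d * seq 'I_d := (Psi f, root_types f).

(* Main.v *)
(**
  Visit the vertices of a forest by always taking, among the pending vertices
  (unvisited, with a visited parent or none), the one of least key, where keys
  compare first the tree, then the breadth-first position of the root of the
  monochromatic subtree, then the breadth-first position of the vertex. A child
  has a larger key than its parent, so this visits all vertices in increasing
  key order, and restricted to type i it lists the vertices of the subforest of
  type i in its own order. The next vertex depends only on the keys and types of
  the pending vertices, and visiting a vertex of type i reads exactly the next
  increment of x^(i), which (the types of siblings being sorted) determines the
  keys and types of its children. Hence (x, c) determines the forest, by induction
  on the number of vertices; conversely x can be decoded as long as x^(i) is not
  exhausted when a vertex of type i is pending. This holds because if r_i > 0 then
  every solution s of (r, x) has s_i > 0, so that reading one increment v of x^(i)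
  matches the solutions of (r, x) with those of (r + v, shifted x): "the length is
  the smallest solution" is invariant under a visit, and for r = 0 it says that x
  has length 0.
*)
Require Import Defs.
From mathcomp Require Import all_boot all_order all_algebra.
From HB Require Import structures.
From mathcomp Require Import zify.
Set Implicit Arguments.
Unset Strict Implicit.
Unset Printing Implicit Defensive.

(** * Induction over children and decidable equality for multitype trees *)

Lemma msize_kids d (t c : mtree d) : List.In c (mkids t) -> msize c < msize t.
Proof.
case: t => i cs /=; elim: cs => //= c' cs IH [->|/IH]; rewrite !ltnS; first exact: leq_addr.
by move=> h; apply: leq_trans h (leq_addl _ _).
Qed.

(** The induction principle generated for this nested inductive type gives no hypothesis on the
    children; induction on [msize] supplies it. *)
Lemma mtree_kids_ind d (P : mtree d -> Prop) :
  (forall i cs, (forall c, List.In c cs -> P c) -> P (MNode i cs)) -> forall t, P t.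
Proof.
move=> H t; have [n] := ubnP (msize t); elim: n t => // n IH [i cs] hn.
apply: H => c hc; apply: IH.
by have := @msize_kids d (MNode i cs) c hc; rewrite /= in hn *; lia.
Qed.

(** Equality on trees is inherited from generic trees without leaves: the type of a vertex becomes
    the number of its node, which [insub] reads back. *)
Fixpoint mtree_encode d (t : mtree d) : GenTree.tree void :=
  let: MNode i cs := t in GenTree.Node i (map (@mtree_encode d) cs).

Fixpoint mtree_decode d (g : GenTree.tree void) : option (mtree d) :=
  if g is GenTree.Node n gs then
    omap (fun i => MNode i (pmap (@mtree_decode d) gs)) (insub n)
  else None.

Lemma mtree_encodeK d : pcancel (@mtree_encode d) (@mtree_decode d).
Proof.
elim/mtree_kids_ind => i cs IH /=; rewrite valK /=; congr (Some (MNode i _)).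
elim: cs IH => //= c cs IHcs IH; rewrite IH /=; last by left.
by congr (c :: _); apply: IHcs => c' hc'; apply: IH; right.
Qed.

HB.instance Definition _ d := Equality.copy (mtree d) (pcan_type (@mtree_encodeK d)).

(** * Keys of vertices *)

(* The key [(n, p, q, b)] of a vertex: [n] is the index of its tree, [q] its path
   from the root, [p] the path of the root of its monochromatic subtree, and [b]
   tells whether it is itself that root. *)
Definition vkey := (nat * seq nat * seq nat * bool)%type.
Definition tree_idx (k : vkey) := k.1.1.1.
Definition sroot_path (k : vkey) := k.1.1.2.
Definition vpath (k : vkey) := k.1.2.
Definition is_sroot (k : vkey) := k.2.

(** Putting the length first makes the lexicographic order on codes the shortlex order on paths,
    which is breadth-first order in a plane tree. *)
Definition bfs_code (p : seq nat) : seq nat := size p :: p.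
Definition key_code (k : vkey) : seqlexi nat :=
  tree_idx k :: bfs_code (sroot_path k) ++ bfs_code (vpath k).
Definition lexlt (s s' : seq nat) : bool := ((s : seqlexi nat) < (s' : seqlexi nat))%O.
Arguments lexlt : simpl never.
Definition key_lt (k k' : vkey) : bool := lexlt (key_code k) (key_code k').
Definition key_le (k k' : vkey) : bool := ~~ key_lt k' k.
Arguments key_lt : simpl never.
Arguments key_le : simpl never.

(** [a] is the position among the siblings and [same] tells whether the child has the type of its
    parent; if not, the child starts a monochromatic subtree of its own. *)
Definition child_key (k : vkey) (same : bool) (a : nat) : vkey :=
  (tree_idx k, if same then sroot_path k else rcons (vpath k) a, rcons (vpath k) a, ~~ same).

Definition wf_key (k : vkey) : bool :=
  (size (sroot_path k) <= size (vpath k)) && (is_sroot k ==> (sroot_path k == vpath k)).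

Lemma lexlt_cons x s y s' : lexlt (x :: s) (y :: s') = (x < y) || (x == y) && lexlt s s'.
Proof. by rewrite /lexlt Order.SeqLexiOrder.ltxi_cons !leEnat; case: ltngtP => //=. Qed.

Lemma lexlt_trans : transitive lexlt.
Proof. by move=> s2 s1 s3; apply: Order.POrderTheory.lt_trans. Qed.

Lemma lexlt_irr : irreflexive lexlt.
Proof. by move=> s; rewrite /lexlt Order.POrderTheory.ltxx. Qed.

Lemma key_lt_trans : transitive key_lt.
Proof. by move=> k2 k1 k3; apply: lexlt_trans. Qed.

Lemma key_lt_irr : irreflexive key_lt.
Proof. by move=> k; apply: lexlt_irr. Qed.

Lemma key_ltW k k' : key_lt k k' -> key_le k k'.
Proof. by rewrite /key_le => h; apply/negP => /(key_lt_trans h); rewrite key_lt_irr. Qed.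

Lemma key_le_refl : reflexive key_le.
Proof. by move=> k; rewrite /key_le key_lt_irr. Qed.

Lemma key_leE k k' : key_le k k' = (key_code k <= key_code k')%O.
Proof. by rewrite /key_le /key_lt /lexlt Order.TotalTheory.leNgt. Qed.

Lemma key_le_trans : transitive key_le.
Proof. by move=> k2 k1 k3; rewrite !key_leE; apply: Order.POrderTheory.le_trans. Qed.

Lemma key_le_total : total key_le.
Proof. by move=> k k'; rewrite !key_leE Order.TotalTheory.le_total. Qed.

Lemma lexlt_cat2l p s s' : lexlt (p ++ s) (p ++ s') = lexlt s s'.
Proof. by elim: p => //= x p IH; rewrite lexlt_cons ltnn eqxx. Qed.

Lemma lexlt_cat_eq_size p p' s s' : size p = size p' -> lexlt p p' -> lexlt (p ++ s) (p' ++ s').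
Proof.
elim: p p' => [|x p IH] [|y p'] //=.
by move=> [hs]; rewrite !lexlt_cons => /orP[->//|/andP[-> /(IH _ hs) ->]]; rewrite orbT.
Qed.

(** Two codes differ either in their leading lengths or at an entry of words of equal length;
    neither is a proper prefix of the other, so what is appended cannot affect the comparison. *)
Lemma bfs_code_lt_cat p p' s s' :
  lexlt (bfs_code p) (bfs_code p') -> lexlt (bfs_code p ++ s) (bfs_code p' ++ s').
Proof.
rewrite /bfs_code /= !lexlt_cons => /orP[->//|/andP[/eqP hs /(lexlt_cat_eq_size _ _ hs) ->]].
by rewrite hs eqxx orbT.
Qed.

Lemma key_lt_idx k k' : tree_idx k < tree_idx k' -> key_lt k k'.
Proof. by move=> h; rewrite /key_lt lexlt_cons h. Qed.

Lemma key_lt_sroot k k' : tree_idx k = tree_idx k' ->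
  lexlt (bfs_code (sroot_path k)) (bfs_code (sroot_path k')) -> key_lt k k'.
Proof. by move=> e h; rewrite /key_lt lexlt_cons e ltnn eqxx; apply: bfs_code_lt_cat. Qed.

Lemma key_lt_path k k' : tree_idx k = tree_idx k' -> sroot_path k = sroot_path k' ->
  lexlt (bfs_code (vpath k)) (bfs_code (vpath k')) -> key_lt k k'.
Proof. by move=> e e' h; rewrite /key_lt lexlt_cons e ltnn eqxx e' lexlt_cat2l. Qed.

Lemma wf_child_key k b a : wf_key k -> wf_key (child_key k b a).
Proof.
rewrite /wf_key => /andP[h _]; rewrite /child_key /sroot_path /vpath /is_sroot /=.
by case: b => /=; rewrite ?eqxx ?leqnn // size_rcons andbT leqW.
Qed.

(** If the type changes, the new subtree root is deeper than the parent, hence deeper than the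
    parent's subtree root; otherwise the subtree root is shared and the child's own path is
    longer. *)
Lemma lt_child_key k b a : wf_key k -> key_lt k (child_key k b a).
Proof.
case/andP=> h _; case: b; last first.
  by apply: key_lt_sroot; rewrite // /bfs_code lexlt_cons /child_key /= size_rcons ltnS h.
by apply: key_lt_path; rewrite // /bfs_code lexlt_cons /child_key /= size_rcons ltnS leqnn.
Qed.

Lemma bfs_code_lt_rcons q a a' : a < a' -> lexlt (bfs_code (rcons q a)) (bfs_code (rcons q a')).
Proof.
by move=> h; rewrite /bfs_code !size_rcons lexlt_cons ltnn eqxx -!cats1 lexlt_cat2l lexlt_cons h.
Qed.

Lemma pairwise_flatten (T : Type) (r : rel T) (ss : seq (seq T)) :
  all (pairwise r) ss -> pairwise (allrel r) ss -> pairwise r (flatten ss).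
Proof.
elim: ss => //= s ss IH /andP[h1 h2] /andP[h3 h4].
rewrite pairwise_cat h1 (IH h2 h4) !andbT.
by elim: ss h3 {IH h2 h4} => [|s' ss IH] /=; rewrite ?allrel0r // allrel_catr => /andP[-> /IH ->].
Qed.

Lemma allrelI (T S : eqType) (r : T -> S -> bool) (s : seq T) (s' : seq S) :
  (forall x y, x \in s -> y \in s' -> r x y) -> allrel r s s'.
Proof. by move=> h; apply/allrelP => x y hx hy; apply: h. Qed.

(** * Breadth-first search *)

Section BreadthFirst.

Variables (X : eqType) (kids : X -> seq X).

Definition gen (g : seq X) : seq X := flatten (map kids g).
Definition bfs (N : nat) (g : seq X) : seq X := flatten [seq iter k gen g | k <- iota 0 N].

Lemma gen_cat g g' : gen (g ++ g') = gen g ++ gen g'.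
Proof. by rewrite /gen map_cat flatten_cat. Qed.

Lemma bfsS N g : bfs N.+1 g = g ++ bfs N (gen g).
Proof.
rewrite /bfs /=; congr (_ ++ flatten _); rewrite (iotaDl 1 0 N) -map_comp.
by apply: eq_map => k; apply: iterSr.
Qed.

Lemma bfs_nil N : bfs N [::] = [::].
Proof. by elim: N => // N IH; rewrite bfsS IH. Qed.

(** The generations of [g] and [g'] interleave, so the searches agree only as multisets. Sums of an
    arbitrary weight [F] express this; indicator weights later turn them into permutations. *)
Lemma sum_bfs_cat (F : X -> nat) N g g' :
  \sum_(w <- bfs N (g ++ g')) F w = \sum_(w <- bfs N g) F w + \sum_(w <- bfs N g') F w.
Proof.
elim: N g g' => [|N IH] g g'; first by rewrite /bfs /= !big_nil.
by rewrite !bfsS gen_cat !big_cat /= IH; lia.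
Qed.

Lemma sum_bfs (F : X -> nat) N g :
  \sum_(w <- bfs N g) F w = \sum_(x <- g) \sum_(w <- bfs N [:: x]) F w.
Proof.
elim: g => [|x g IH]; first by rewrite bfs_nil !big_nil.
by rewrite -cat1s sum_bfs_cat IH big_cons.
Qed.

Lemma sum_bfsS (F : X -> nat) N x :
  \sum_(w <- bfs N.+1 [:: x]) F w = F x + \sum_(y <- kids x) \sum_(w <- bfs N [:: y]) F w.
Proof. by rewrite bfsS big_cat big_seq1 /= sum_bfs /gen /= cats0. Qed.

Variable ht : X -> nat.
Hypothesis ht_kids : forall x y, y \in kids x -> ht y < ht x.

(** Since [ht] decreases from parent to child, the generations beyond [ht x] are empty. *)
Lemma sum_bfs_stable (F : X -> nat) N N' x : ht x < N -> ht x < N' ->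
  \sum_(w <- bfs N [:: x]) F w = \sum_(w <- bfs N' [:: x]) F w.
Proof.
elim: N N' x => // N IH [|N'] // x h h'; rewrite !sum_bfsS; congr (_ + _).
rewrite !big_seq; apply: eq_bigr => y /ht_kids hy.
by apply: IH; apply: leq_trans hy _; rewrite -ltnS.
Qed.

Definition desc (x : X) : seq X := bfs (ht x).+1 [:: x].

Lemma sum_desc (F : X -> nat) x :
  \sum_(w <- desc x) F w = F x + \sum_(y <- kids x) \sum_(w <- desc y) F w.
Proof.
rewrite /desc sum_bfsS; congr (_ + _); rewrite !big_seq; apply: eq_bigr => y /ht_kids hy.
exact: sum_bfs_stable.
Qed.

Lemma perm_desc x : perm_eq (desc x) (x :: flatten (map desc (kids x))).
Proof.
apply/permP => a; rewrite -!sum1_count !(big_mkcond a) /= sum_desc big_cons big_flatten /=.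
by rewrite big_map.
Qed.

Lemma desc_ind (I : X -> X -> Prop) :
  (forall x, I x x) -> (forall x y z, y \in kids x -> I y z -> I x z) ->
  forall x z, z \in desc x -> I x z.
Proof.
move=> I0 IS x; have [n] := ubnP (ht x); elim: n x => // n IH x hn z.
rewrite (perm_mem (perm_desc x)) inE => /predU1P[->//|/flatten_mapP[y hy hz]].
by apply: (IS x y) => //; apply: IH => //; apply: leq_trans (ht_kids hy) _; rewrite -ltnS.
Qed.

Variable pth : X -> seq nat.
Hypothesis pth_kids : forall x y, y \in kids x -> exists a, pth y = rcons (pth x) a.
Let plt x y := lexlt (bfs_code (pth x)) (bfs_code (pth y)).
Hypothesis plt_kids : forall x, pairwise plt (kids x).

(** All paths of a generation have the same length. Children of different parents are then compared
    as their parents are, and siblings by hypothesis. *)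
Lemma plt_iter_gen k g : (forall x y, x \in g -> y \in g -> size (pth x) = size (pth y)) ->
  pairwise plt g ->
  [/\ pairwise plt (iter k gen g) &
   forall x y, x \in g -> y \in iter k gen g -> size (pth y) = size (pth x) + k].
Proof.
elim: k g => [|k IH] g hsz hpw.
  by split=> // x y hx hy; rewrite addn0; apply: hsz.
rewrite iterSr.
have hgen x y : x \in g -> y \in gen g -> size (pth y) = (size (pth x)).+1.
  by move=> hx /flatten_mapP[z hz /pth_kids[a ->]]; rewrite size_rcons (hsz x z).
have [||h1 h2] := IH (gen g).
- move=> y y' /flatten_mapP[z hz hy] hy'.
  by rewrite (hgen z y) ?(hgen z y') //; apply/flatten_mapP; exists z.
- apply: pairwise_flatten; first by apply/allP => s /mapP[x _ ->].
  rewrite pairwise_map; apply: (@sub_in_pairwise _ (mem g)) hpw; last exact/allP.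
  move=> x y hx hy; rewrite /= /plt /bfs_code !lexlt_cons (hsz x y) // ltnn eqxx /= => hxy.
  apply: allrelI => x' y' /pth_kids[a ->] /pth_kids[b ->].
  rewrite !size_rcons (hsz x y) // lexlt_cons ltnn eqxx /= -!cats1.
  by apply: lexlt_cat_eq_size => //; apply: hsz.
split=> // x y hx hy.
(* The length statement for later generations is relative to a member of [gen g]; one exists, since
   an empty generation has no descendants. *)
have [z hz] : exists z, z \in gen g.
  case E: (gen g) hy => [|z ?]; last by exists z; rewrite mem_head.
  by have -> : iter k gen [::] = [::] by elim: (k) => //= ? ->.
by rewrite (h2 z y) // (hgen x z) // addnS.
Qed.

(** Across generations the lengths of the paths decide; inside one generation the previous lemma
    does. *)
Lemma pairwise_desc x : pairwise plt (desc x).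
Proof.
have hk k : pairwise plt (iter k gen [:: x]) /\
    forall y, y \in iter k gen [:: x] -> size (pth y) = size (pth x) + k.
  have [||h1 h2] := @plt_iter_gen k [:: x].
  - by move=> y z; rewrite !inE => /eqP-> /eqP->.
  - by [].
  - by split=> // y; apply: h2; rewrite mem_head.
apply: pairwise_flatten.
  by apply/allP => s /mapP[k _ ->]; apply: (hk k).1.
rewrite pairwise_map; apply: sub_pairwise (_ : pairwise ltn _); last first.
  by rewrite -(sorted_pairwise ltn_trans) iota_ltn_sorted.
move=> k k' /= lt_k; apply: allrelI => y z /(hk k).2 hy /(hk k').2 hz.
by rewrite /plt /bfs_code lexlt_cons hy hz ltn_add2l lt_k.
Qed.

End BreadthFirst.

(** * Visiting order of a forest *)

Definition enumerate (T : Type) (s : seq T) : seq (nat * T) := zip (iota 0 (size s)) s.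

Lemma enumerate_snd (T : Type) (s : seq T) : map snd (enumerate s) = s.
Proof. by rewrite -/unzip2 unzip2_zip ?size_iota. Qed.

Lemma enumerate_map (T S : Type) (f : T -> S) s :
  enumerate (map f s) = [seq (p.1, f p.2) | p <- enumerate s].
Proof.
rewrite /enumerate size_map; move: (iota _ _) => r.
by elim: s r => [|x s IH] [|y r] //=; rewrite IH.
Qed.

Lemma pairwise_enumerate (T : Type) (s : seq T) :
  pairwise (fun x y => x.1 < y.1) (enumerate s).
Proof.
rewrite -(pairwise_map fst (fun a b => a < b)) -/unzip1 unzip1_zip ?size_iota //.
by rewrite -(sorted_pairwise ltn_trans) iota_ltn_sorted.
Qed.

Section KeyedVertices.

Variable d : nat.

Definition kvert := (vkey * mtree d)%type.
HB.instance Definition _ := Equality.on kvert.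

Definition vkids (x : kvert) : seq kvert :=
  [seq (child_key x.1 (mlabel p.2 == mlabel x.2) p.1, p.2) | p <- enumerate (mkids x.2)].
Definition vkids_of (i : 'I_d) (x : kvert) : seq kvert :=
  [seq y <- vkids x | mlabel y.2 == i].
(** This is the size minus one, an upper bound on the height, chosen so that [desc] runs through
    exactly as many generations as [tree_bfs] and [mono_bfs]. *)
Definition vheight (x : kvert) : nat := sumn (map (@msize d) (mkids x.2)).
Definition vdesc (x : kvert) : seq kvert := desc vkids vheight x.
Definition mono_desc (x : kvert) : seq kvert := desc (vkids_of (mlabel x.2)) vheight x.
Definition sroot_order (x : kvert) : seq kvert :=
  flatten [seq mono_desc w | w <- vdesc x & is_sroot w.1].
Definition kvert_lt (x y : kvert) : bool := key_lt x.1 y.1.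

Lemma msizeE (t : mtree d) : msize t = (sumn (map (@msize d) (mkids t))).+1.
Proof. by case: t. Qed.

Lemma vkidsP x y : y \in vkids x -> exists a,
  [/\ y.1 = child_key x.1 (mlabel y.2 == mlabel x.2) a & y.2 \in mkids x.2].
Proof.
move=> /mapP[[a c] hac ->]; exists a; split=> //=.
by rewrite -(enumerate_snd (mkids x.2)); apply/mapP; exists (a, c).
Qed.

Lemma map_snd_vkids x : map snd (vkids x) = mkids x.2.
Proof. by rewrite -map_comp -[RHS]enumerate_snd; apply: eq_map. Qed.

Lemma vheight_kids x y : y \in vkids x -> vheight y < vheight x.
Proof.
move=> /vkidsP[a [_]]; rewrite /vheight; set n := sumn _ => hy.
have -> : n = (msize y.2).-1 by rewrite msizeE.
case/splitPr: hy => s1 s2; rewrite map_cat sumn_cat /= (msizeE y.2) /=; lia.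
Qed.

Lemma vheight_kids_of i x y : y \in vkids_of i x -> vheight y < vheight x.
Proof. by rewrite mem_filter => /andP[_ /vheight_kids]. Qed.

Lemma vpath_kids x y : y \in vkids x -> exists a, vpath y.1 = rcons (vpath x.1) a.
Proof. by move=> /vkidsP[a [-> _]]; exists a. Qed.

Lemma pairwise_vkids x :
  pairwise (fun y z => lexlt (bfs_code (vpath y.1)) (bfs_code (vpath z.1))) (vkids x).
Proof.
rewrite pairwise_map; apply: sub_pairwise (pairwise_enumerate _) => p q /= h.
exact: bfs_code_lt_rcons.
Qed.

Lemma vdesc_inv x z : z \in vdesc x ->
  tree_idx z.1 = tree_idx x.1 /\
  (wf_key x.1 -> wf_key z.1 /\ key_le x.1 z.1).
Proof.
pose I (x z : kvert) := tree_idx z.1 = tree_idx x.1 /\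
  (wf_key x.1 -> wf_key z.1 /\ key_le x.1 z.1).
move: x z; apply: (desc_ind vheight_kids (I := I)) => [x|x y z]; rewrite /I.
  by split=> // h; rewrite key_le_refl.
move=> /vkidsP[a [ey _]] [h1 h2]; rewrite h1 ey; split=> // hx.
have hy : wf_key y.1 by rewrite ey wf_child_key.
have [-> hyz] := h2 hy; split=> //; apply: key_le_trans hyz; apply: key_ltW.
by rewrite ey lt_child_key.
Qed.

Lemma mono_desc_inv x z : z \in mono_desc x ->
  [/\ mlabel z.2 = mlabel x.2, tree_idx z.1 = tree_idx x.1 &
      sroot_path z.1 = sroot_path x.1].
Proof.
(* The followed type is fixed as [i], so that the induction moves down the tree with a child
   function that stays the same. *)
rewrite /mono_desc; move: {1 3}(mlabel x.2) (erefl (mlabel x.2)) => i.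
pose I (x z : kvert) := i = mlabel x.2 -> [/\ mlabel z.2 = mlabel x.2,
  tree_idx z.1 = tree_idx x.1 & sroot_path z.1 = sroot_path x.1].
move=> hi hz; move: x z hz hi.
apply: (desc_ind (@vheight_kids_of i) (I := I)) => [x|x y z]; rewrite /I //.
rewrite mem_filter => /andP[/eqP hi /vkidsP[a [ey _]]] IH hx.
by have [-> -> ->] := IH (esym hi); rewrite ey hi hx eqxx.
Qed.

Lemma sum_mono_desc (F : kvert -> nat) x :
  \sum_(w <- mono_desc x) F w =
  F x + \sum_(y <- vkids x | mlabel y.2 == mlabel x.2) \sum_(w <- mono_desc y) F w.
Proof.
rewrite /mono_desc (sum_desc (@vheight_kids_of _)) big_filter; congr (_ + _).
by apply: eq_bigr => y /eqP ->.
Qed.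

(** The descendants of [x] split into the subtree of its own type containing it and the
    monochromatic subtrees started strictly below it. A child of the same type contributes to the
    first part, a child of another type starts a subtree in the second. *)
Lemma sum_vdesc_mono (F : kvert -> nat) x :
  \sum_(w <- vdesc x) F w = \sum_(w <- mono_desc x) F w +
    \sum_(y <- vkids x) \sum_(w <- vdesc y | is_sroot w.1) \sum_(z <- mono_desc w) F z.
Proof.
have [n] := ubnP (vheight x); elim: n x => // n IH x hn.
rewrite /vdesc (sum_desc vheight_kids) sum_mono_desc -addnA; congr (_ + _).
rewrite [X in X + _]big_mkcond -big_split /= !big_seq; apply: eq_bigr => y hy.
rewrite -/(vdesc y) IH; last by have := vheight_kids hy; lia.
rewrite [X in _ = _ + X]big_mkcond /= [X in _ = _ + X](sum_desc vheight_kids) addnA.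
congr (_ + _).
  have [a [-> _]] := vkidsP hy; rewrite /is_sroot /=.
  by case: (_ == _); rewrite /= ?addn0 ?add0n.
by apply: eq_bigr => z _; rewrite [LHS]big_mkcond.
Qed.

Lemma perm_sroot_order x : is_sroot x.1 -> perm_eq (sroot_order x) (vdesc x).
Proof.
move=> hx; apply/permP => a; rewrite -!sum1_count ![LHS]big_mkcond ![RHS]big_mkcond /=.
rewrite sum_vdesc_mono /sroot_order big_flatten big_map big_filter big_mkcond.
rewrite /vdesc (sum_desc vheight_kids) hx; congr (_ + _).
by apply: eq_bigr => z _; rewrite [RHS]big_mkcond.
Qed.

Lemma sroot_order_idx x z : z \in sroot_order x -> tree_idx z.1 = tree_idx x.1.
Proof.
move=> /flatten_mapP[w]; rewrite mem_filter => /andP[_ /vdesc_inv[<- _]].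
by move=> /mono_desc_inv[].
Qed.

(** Inside a monochromatic subtree [sroot_path] is constant, so breadth-first order of [vpath]
    decides. Between two subtrees the roots decide: they come in breadth-first order, and at a root
    [sroot_path] equals [vpath]. *)
Lemma pairwise_sroot_order x : wf_key x.1 -> pairwise kvert_lt (sroot_order x).
Proof.
move=> hx; apply: pairwise_flatten.
  apply/allP => _ /mapP[w _ ->].
  have h := @pairwise_desc _ (vkids_of (mlabel w.2)) vheight (fun y => vpath y.1).
  apply: (sub_in_pairwise _ (allss _) (h _ _ w)).
  - move=> y z /mono_desc_inv[_ hy hy'] /mono_desc_inv[_ hz hz'] hyz.
    by apply: key_lt_path; rewrite ?hy ?hz ?hy' ?hz'.
  - by move=> y z; rewrite mem_filter => /andP[_ /vpath_kids].
  - by move=> y; apply: pairwise_filter; apply: pairwise_vkids.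
rewrite pairwise_map.
have := @pairwise_desc _ _ vheight (fun y => vpath y.1) vpath_kids pairwise_vkids x.
move=> /(pairwise_filter (fun w => is_sroot w.1)).
apply: (sub_in_pairwise _ (allss _)) => w w'.
rewrite !mem_filter => /andP[rw /vdesc_inv[iw /(_ hx)[/andP[_ ww] _]]].
move=> /andP[rw' /vdesc_inv[iw' /(_ hx)[/andP[_ ww'] _]]] hlt.
apply: allrelI => z z' /mono_desc_inv[_ hz hz'] /mono_desc_inv[_ hy hy'].
apply: key_lt_sroot; first by rewrite hz hy iw iw'.
rewrite hz' hy'; rewrite rw in ww; rewrite rw' in ww'.
by rewrite (eqP ww) (eqP ww').
Qed.

Lemma perm_vdesc x : perm_eq (vdesc x) (x :: flatten (map vdesc (vkids x))).
Proof. exact: perm_desc vheight_kids x. Qed.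

Lemma map_snd_mono_desc x : map snd (mono_desc x) = mono_bfs x.2.
Proof.
rewrite /mono_desc /desc /bfs /mono_bfs -msizeE map_flatten -map_comp; congr flatten.
apply: eq_map => k /=; elim: k => //= k <-.
rewrite /gen /next_mgen map_flatten -!map_comp; congr flatten; apply: eq_map => w /=.
by rewrite -map_snd_vkids filter_map.
Qed.

Definition flagged (x : kvert) : mtree d * bool := (x.2, is_sroot x.1).

Lemma map_flagged_vdesc x : is_sroot x.1 -> map flagged (vdesc x) = tree_bfs x.2.
Proof.
move=> hx; rewrite /vdesc /desc /bfs /tree_bfs -msizeE map_flatten -map_comp; congr flatten.
apply: eq_map => k /=; elim: k => [|k IH] /=; first by rewrite /flagged hx.
rewrite -IH /gen /next_gen map_flatten -!map_comp; congr flatten; apply: eq_map => w /=.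
by rewrite -[in RHS](enumerate_snd (mkids _)) -!map_comp; apply: eq_map.
Qed.

Definition root_key (n : nat) : vkey := (n, [::], [::], true).

Definition keyed_forest (f : seq (mtree d)) : seq kvert :=
  [seq (root_key p.1, p.2) | p <- enumerate f].

Definition explore_order (f : seq (mtree d)) : seq kvert :=
  flatten (map sroot_order (keyed_forest f)).

Lemma keyed_forestP f x : x \in keyed_forest f -> is_sroot x.1 /\ wf_key x.1.
Proof. by case/mapP=> p _ ->. Qed.

Lemma perm_explore_order f :
  perm_eq (explore_order f) (flatten (map vdesc (keyed_forest f))).
Proof.
rewrite /explore_order; have := @keyed_forestP f.
elim: (keyed_forest f) => // x L IH h; apply: perm_cat.
  by apply: perm_sroot_order; apply: (h x (mem_head _ _)).1.
by apply: IH => y hy; apply: h; rewrite inE hy orbT.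
Qed.

Lemma pairwise_explore_order f : pairwise kvert_lt (explore_order f).
Proof.
apply: pairwise_flatten.
  by apply/allP => _ /mapP[x /keyed_forestP[_ hx] ->]; apply: pairwise_sroot_order.
rewrite !pairwise_map; apply: sub_pairwise (pairwise_enumerate f) => p q /= h.
by apply: allrelI => y z /sroot_order_idx hy /sroot_order_idx hz; apply: key_lt_idx; rewrite hy hz.
Qed.

Lemma forest_bfs_keyed f :
  forest_bfs f = map flagged (flatten (map vdesc (keyed_forest f))).
Proof.
rewrite /forest_bfs map_flatten -!map_comp -[in LHS](enumerate_snd f) -map_comp.
congr flatten; apply: eq_map => p.
by apply/esym; apply: (@map_flagged_vdesc (root_key p.1, p.2)).
Qed.

Local Opaque mono_desc vdesc.

(** The exploration order is a concatenation of monochromatic subtrees, and selecting type [i] keeps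
    or discards each of them as a whole. *)
Lemma subforest_vertices_keyed f i :
  subforest_vertices f i = [seq u <- map snd (explore_order f) | mlabel u == i].
Proof.
have -> : explore_order f = flatten
    [seq mono_desc w | w <- flatten (map vdesc (keyed_forest f)) & is_sroot w.1].
  rewrite /explore_order; elim: (keyed_forest f) => // x L IH.
  rewrite -[flatten (map vdesc _)]/(vdesc x ++ flatten (map vdesc L)).
  by rewrite filter_cat map_cat flatten_cat -IH.
rewrite /subforest_vertices forest_bfs_keyed.
elim: (flatten (map vdesc _)) => //= w D IHD; case rw: (is_sroot w.1) => //=.
rewrite map_cat filter_cat -IHD map_snd_mono_desc.
have -> : [seq u <- mono_bfs w.2 | mlabel u == i] = if mlabel w.2 == i then mono_bfs w.2 else [::].
  rewrite -map_snd_mono_desc; case: ifP => hi;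
    [apply/all_filterP|apply/eqP; rewrite -[_ == _]negbK -has_filter -all_predC];
  by apply/allP => _ /mapP[z /mono_desc_inv[hz _ _] ->] /=; rewrite hz hi.
by case: ifP.
Qed.

End KeyedVertices.

(** * Exploration by least key *)

(** A position rather than a key is returned, so that two pending lists with the same keys are
    visited at the same place. *)
Definition min_idx (ks : seq vkey) : nat := find (fun k => all (key_le k) ks) ks.

Lemma has_min_key (ks : seq vkey) : ks != [::] -> has (fun k => all (key_le k) ks) ks.
Proof.
elim: ks => // k [_ _|k' ks /(_ isT) /hasP[m hm hall] _]; first by rewrite /= key_le_refl.
have [hkm|hmk] := orP (key_le_total k m).
  apply/hasP; exists k; rewrite ?mem_head //=; rewrite key_le_refl /=.
  by move: hall; apply: sub_all => z; apply: key_le_trans.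
by apply/hasP; exists m; [rewrite inE hm orbT | rewrite /= hmk].
Qed.

Lemma min_idx_lt ks : ks != [::] -> min_idx ks < size ks.
Proof. by move=> /has_min_key; rewrite has_find. Qed.

Lemma min_idxP (s : seq vkey) k s' :
  min_idx (s ++ k :: s') = size s -> all (key_le k) (s ++ k :: s').
Proof.
move=> h; have hn : s ++ k :: s' != [::] by case: (s).
have := nth_find k (has_min_key hn); rewrite -/(min_idx _) h nth_cat ltnn subnn.
exact.
Qed.

Lemma split_nth (T : Type) (x0 : T) n s : n < size s ->
  s = take n s ++ nth x0 s n :: drop n.+1 s /\ size (take n s) = n.
Proof. by move=> h; rewrite -drop_nth // cat_take_drop size_takel // ltnW. Qed.

Section Exploration.

Variable d : nat.
Implicit Types (L A B : seq (kvert d)) (x : kvert d) (e : seq (mtree d)).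

Definition min_pos L : nat := min_idx [seq x.1 | x <- L].

(* The pending vertices are [A ++ x :: B]; the pending vertex of least key is
   visited and replaced by its children. *)
Inductive explores : seq (kvert d) -> seq (mtree d) -> Prop :=
| explores_nil : explores [::] [::]
| explores_cons A x B e : min_pos (A ++ x :: B) = size A ->
    explores (A ++ vkids x ++ B) e -> explores (A ++ x :: B) (x.2 :: e).

Definition total_size L : nat := sumn [seq msize x.2 | x <- L].

Lemma total_size_pop A x B : total_size (A ++ vkids x ++ B) < total_size (A ++ x :: B).
Proof.
rewrite /total_size !map_cat !sumn_cat /= msizeE -map_snd_vkids -map_comp.
rewrite (eq_map (_ : _ =1 (fun x => msize x.2))) //; lia.
Qed.

Lemma explores_total L : exists e, explores L e.
Proof.
have [n] := ubnP (total_size L); elim: n L => // n IH [|x0 L'] hn.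
  by exists [::]; apply: explores_nil.
set L := x0 :: L' in hn *.
have hm : min_pos L < size L by rewrite -(size_map fst) min_idx_lt.
have [hL hsz] := split_nth x0 hm.
move: hsz hL; set A := take _ _; set x := nth _ _ _; set B := drop _ _ => hsz hL.
have [|e he] := IH (A ++ vkids x ++ B).
  by have := total_size_pop A x B; rewrite -hL; lia.
by exists (x.2 :: e); rewrite hL; apply: explores_cons; rewrite -?hL.
Qed.

(** The least pending key is a lower bound for the keys of all descendants of pending vertices. The
    visited vertex is thus the head of the increasing list [E], and the tail of [E] lists the
    descendants of the new pending vertices. *)
Lemma explores_sorted L e : explores L e -> forall E, all (fun x => wf_key x.1) L ->
  pairwise (@kvert_lt d) E -> perm_eq E (flatten (map (@vdesc d) L)) -> map snd E = e.
Proof.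
elim=> {L e} [E _ _|A x B e hm hL IH E hwf hE hp].
  by move=> /perm_nilP ->.
(* Replacing [x] by its children removes only [x] from the vertices still to be visited. *)
have hD : perm_eq (flatten (map (@vdesc d) (A ++ x :: B)))
                  (x :: flatten (map (@vdesc d) (A ++ vkids x ++ B))).
  rewrite !map_cat !flatten_cat -[flatten (map _ (x :: B))]/(vdesc x ++ flatten (map (@vdesc d) B)).
  move: (vdesc x) (perm_vdesc x) => D /permP hD; apply/permP => a.
  by have /= hDa := hD a; rewrite /= !count_cat hDa -addnA addnCA.
have hxmin y : y \in flatten (map (@vdesc d) (A ++ x :: B)) -> key_le x.1 y.1.
  move=> /flatten_mapP[z hz /vdesc_inv[_ /(_ (allP hwf z hz))[_ hzy]]].
  apply: key_le_trans hzy; move: hm; rewrite /min_pos map_cat map_cons => hm.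
  have /allP := min_idxP (etrans hm (esym (size_map _ _))); apply.
  by rewrite -map_cons -map_cat map_f.
case: E hE hp => [|y E] hE hp.
  by have := perm_size (perm_trans hp hD).
have hxy : y = x.
  (* Were [x] in the tail of the list, [y] would have a key strictly below the least one. *)
  have : x \in y :: E by rewrite (perm_mem (perm_trans hp hD)) mem_head.
  rewrite inE => /predU1P[//|hx].
  have := hxmin y; rewrite -(perm_mem hp) mem_head => /(_ isT).
  by move: hE => /= /andP[/allP /(_ x hx)]; rewrite /kvert_lt /key_le => ->.
rewrite hxy /=; congr (_ :: _); apply: IH.
- move: hwf; rewrite !all_cat /= => /and3P[-> hx ->]; rewrite andbT /=.
  by apply/allP => z /vkidsP[a [-> _]]; apply: wf_child_key.
- by move: hE => /= /andP[].
- by have := perm_trans hp hD; rewrite hxy perm_cons.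
Qed.

(** * Offspring streams and the smallest-solution condition over the natural numbers *)

Definition typevec := {ffun 'I_d -> nat}.
HB.instance Definition _ := Equality.on typevec.

Definition child_vec (u : mtree d) : typevec := [ffun j => pchildren u j].
Definition stream e (i : 'I_d) : seq typevec := [seq child_vec u | u <- e & mlabel u == i].

Implicit Types (r n : 'I_d -> nat) (s : 'I_d -> seq typevec) (v : typevec).

(** This is the equation of a solution of $(\mathrm r,x)$ with the decrements of $x^{j,j}$ moved to
    the other side: the vertices of type [j] used up are the [r j] roots together with the children
    produced. *)
Definition consumption_sol (r : 'I_d -> nat) (s : 'I_d -> seq typevec) (n : 'I_d -> nat) :=
  (forall i, n i <= size (s i)) /\
  (forall j, n j = r j + \sum_(i < d) \sum_(v <- take (n i) (s i)) v j).

Definition extinction (r : 'I_d -> nat) (s : 'I_d -> seq typevec) :=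
  consumption_sol r s (fun i => size (s i)) /\
  (forall n, consumption_sol r s n -> forall i, size (s i) <= n i).

Lemma consumption_sol_gt0 r s n i : consumption_sol r s n -> 0 < r i -> 0 < n i.
Proof. by move=> [_ ->]; rewrite addn_gt0 => ->. Qed.

(** Reading [v] from the stream of type [i] shifts both sides of the equations equally. The new
    vectors are given through sums, which avoids truncated subtraction. *)
Lemma consumption_sol_pop r (r' : 'I_d -> nat) s (s' : 'I_d -> seq typevec)
    n (n' : 'I_d -> nat) i v :
  s i = v :: s' i -> (forall j, j != i -> s j = s' j) ->
  (forall j, r' j + (j == i) = r j + v j) -> (forall j, n j = n' j + (j == i)) ->
  consumption_sol r s n <-> consumption_sol r' s' n'.
Proof.
move=> hsi hs hr hn.
have hsum j : \sum_(k < d) \sum_(w <- take (n k) (s k)) w j =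
    v j + \sum_(k < d) \sum_(w <- take (n' k) (s' k)) w j.
  rewrite (bigD1 i) //= [in RHS](bigD1 i) //= hsi hn eqxx addn1 /= big_cons -addnA.
  by do 2!congr (_ + _); apply: eq_bigr => k hk; rewrite hn (negbTE hk) addn0 hs.
split=> -[h1 h2]; split=> j.
- have := h1 j; rewrite hn; case: (eqVneq j i) => [->|/hs ->]; last by rewrite addn0.
  by rewrite hsi /= addn1.
- by have := h2 j; have := hr j; rewrite hsum hn; lia.
- have := h1 j; rewrite hn; case: (eqVneq j i) => [->|/hs ->]; last by rewrite addn0.
  by rewrite hsi /= addn1.
- by have := h2 j; have := hr j; rewrite hsum hn; lia.
Qed.

(** As [0 < r i], every solution uses at least one entry of stream [i], so removing that entry
    matches all solutions of the two problems and preserves minimality. *)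
Lemma extinction_pop r (r' : 'I_d -> nat) s (s' : 'I_d -> seq typevec) i v :
  s i = v :: s' i -> (forall j, j != i -> s j = s' j) ->
  (forall j, r' j + (j == i) = r j + v j) -> 0 < r i ->
  extinction r s <-> extinction r' s'.
Proof.
move=> hsi hs hr ri.
have hsz j : size (s j) = size (s' j) + (j == i).
  by case: (eqVneq j i) => [->|/hs ->]; rewrite ?hsi ?addn0 //= addn1.
have pop := consumption_sol_pop hsi hs hr.
split=> -[hsol hmin]; split.
- by rewrite -(pop _ _ hsz).
- move=> n' hn' j; have := hmin _ (iffRL (pop _ n' (fun j => erefl _)) hn') j.
  by rewrite hsz leq_add2r.
- by rewrite (pop _ _ hsz).
- move=> n hn j; rewrite hsz.
  (* The truncated subtraction is exact because [n i] is positive. *)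
  have hnn k : n k = n k - (k == i) + (k == i).
    case: eqVneq => [->|_]; last by rewrite addn0 subn0.
    by rewrite subnK // (consumption_sol_gt0 hn).
  have hn' : consumption_sol r' s' (fun k => n k - (k == i)) by rewrite -(pop _ _ hnn).
  by rewrite hnn leq_add2r; have := hmin _ hn' j.
Qed.

(** With no root the zero vector is a solution, so minimality forces empty streams. *)
Lemma extinction0 r s : (forall j, r j = 0) -> extinction r s <-> forall i, s i = [::].
Proof.
move=> r0; split=> [[_ hmin]|s0]; last first.
  split; [split=> // j|by move=> n _ i; rewrite s0].
  by rewrite s0 r0 big1 // => i _; rewrite s0 big_nil.
have sol0 : consumption_sol r s (fun=> 0).
  by split=> // j; rewrite r0 big1 // => k _; rewrite take0 big_nil.
by move=> i; apply: size0nil; apply/eqP; rewrite -leqn0; have := hmin _ sol0 i.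
Qed.

(** The skeleton is what a decoder knows of the pending vertices before reading their offspring. *)
Definition skel L : seq (vkey * 'I_d) := [seq (x.1, mlabel x.2) | x <- L].
Definition kid_skel (k : vkey) (i : 'I_d) (ls : seq 'I_d) : seq (vkey * 'I_d) :=
  [seq (child_key k (p.2 == i) p.1, p.2) | p <- enumerate ls].
Definition type_count (K : seq (vkey * 'I_d)) (j : 'I_d) : nat := count (fun p => p.2 == j) K.

Lemma size_skel L : size (skel L) = size L.
Proof. exact: size_map. Qed.

Lemma skel_vkids x : skel (vkids x) = kid_skel x.1 (mlabel x.2) (map (@mlabel d) (mkids x.2)).
Proof. by rewrite /kid_skel enumerate_map /skel -!map_comp; apply: eq_map. Qed.

Lemma type_count_kid_skel k i ls j : type_count (kid_skel k i ls) j = count_mem j ls.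
Proof.
by rewrite /type_count /kid_skel count_map -[in RHS](enumerate_snd ls) count_map; apply: eq_count.
Qed.

Lemma min_pos_skel L : min_pos L = min_idx (map fst (skel L)).
Proof. by rewrite /skel -map_comp. Qed.

Lemma child_vecE (u : mtree d) j : child_vec u j = count_mem j (map (@mlabel d) (mkids u)).
Proof. by rewrite ffunE /pchildren count_map. Qed.

Lemma type_count_pop KA KB k i ls j (v : typevec) :
  (forall j, count_mem j ls = v j) ->
  type_count (KA ++ kid_skel k i ls ++ KB) j + (j == i) =
  type_count (KA ++ (k, i) :: KB) j + v j.
Proof.
move=> hv; rewrite /type_count !count_cat -!/(type_count _ j) type_count_kid_skel hv /= eq_sym.
lia.
Qed.

Lemma stream_cons u e j :
  stream (u :: e) j = if mlabel u == j then child_vec u :: stream e j else stream e j.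
Proof. by rewrite /stream /=; case: ifP. Qed.

(** Each visit is one application of [extinction_pop], and the exploration ends with no pending
    vertex. *)
Lemma explores_extinction L e : explores L e -> extinction (type_count (skel L)) (stream e).
Proof.
elim=> {L e} [|A x B e _ _ IH]; first by apply/extinction0.
apply/(@extinction_pop _ _ _ (stream e) (mlabel x.2) (child_vec x.2)); last exact: IH.
- by rewrite stream_cons eqxx.
- by move=> j hj; rewrite stream_cons eq_sym (negbTE hj).
- move=> j; rewrite /skel !map_cat -!/(skel _) skel_vkids /=.
  by apply: type_count_pop => k; rewrite child_vecE.
- by rewrite /type_count /skel map_cat count_cat /= eqxx addn_gt0 orbT.
Qed.

Lemma sorted_types_inj (ls ls' : seq 'I_d) :
  sorted leq (map val ls) -> sorted leq (map val ls') ->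
  (forall j, count_mem j ls = count_mem j ls') -> ls = ls'.
Proof.
move=> h h' hc; apply: (inj_map val_inj); apply: (sorted_eq leq_trans anti_leq) => //.
by apply: perm_map; apply/allP => j _ /=; rewrite hc.
Qed.

Lemma sorted_types_exist (v : typevec) :
  exists ls : seq 'I_d, sorted leq (map val ls) /\ forall j, count_mem j ls = v j.
Proof.
exists (sort (relpre val leq) (flatten [seq nseq (v j) j | j <- enum 'I_d])); split.
  by rewrite sorted_map sort_sorted // => i j; apply: leq_total.
move=> j; rewrite (permP (permEl (perm_sort _ _))) count_flatten sumnE !big_map -enumT big_enum /=.
rewrite (bigD1 j) //= count_nseq /= eqxx mul1n big1 ?addn0 // => k hk.
by rewrite count_nseq /= (negbTE hk).
Qed.

Lemma mwfE (t : mtree d) :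
  mwf t = sorted leq (map val (map (@mlabel d) (mkids t))) && all (@mwf d) (mkids t).
Proof. by case: t => i cs /=; rewrite -map_comp. Qed.

Definition wf_forest L : bool := all (fun x => mwf x.2) L.

Lemma wf_forest_vkids x : wf_forest (vkids x) = all (@mwf d) (mkids x.2).
Proof. by rewrite -map_snd_vkids all_map. Qed.

Lemma cat_inj (T : Type) (s1 s2 s1' s2' : seq T) : size s1 = size s1' ->
  s1 ++ s2 = s1' ++ s2' -> s1 = s1' /\ s2 = s2'.
Proof. by elim: s1 s1' => [|y s1 IH] [|y' s1'] //= [hs] [-> /(IH _ hs)[-> ->]]. Qed.

(** Equal skeletons make both explorations visit the same position. Equal streams then give the same
    offspring vector, hence the same sorted child types and equal skeletons after the visit; the
    induction hypothesis identifies the children, and with them the visited subtrees. *)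
Lemma explores_inj L e : explores L e -> forall L' e', explores L' e' ->
  skel L = skel L' -> wf_forest L -> wf_forest L' ->
  (forall i, stream e i = stream e' i) -> L = L'.
Proof.
elim=> {L e} [|A x B e hm _ IH] L' e' [|A' x' B' f hm' hf] hs hw hw' hst //.
- by case: A' hs {hm' hf hw'}.
- by case: A hs {hm hw IH}.
have hsz : size A = size A' by rewrite -hm -hm' !min_pos_skel hs.
move: hs; rewrite /skel !map_cat !map_cons => /cat_inj; rewrite !size_map => /(_ hsz).
move=> [hA [hk hl hB]].
have hv : child_vec x.2 = child_vec x'.2 /\ forall i, stream e i = stream f i.
  have := hst (mlabel x.2); rewrite !stream_cons eqxx -hl eqxx => -[-> h]; split=> // i.
  have := hst i; rewrite !stream_cons -hl; case: eqP => [<-|//] [].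
  by [].
move: hw hw'; rewrite /wf_forest !all_cat /= -!/(wf_forest _).
move=> /and3P[wA wx wB] /and3P[wA' wx' wB'].
move: wx wx'; rewrite !mwfE -!wf_forest_vkids => /andP[sx wx] /andP[sx' wx'].
have hls : map (@mlabel d) (mkids x.2) = map (@mlabel d) (mkids x'.2).
  by apply: sorted_types_inj => // j; rewrite -!child_vecE hv.1.
have hsk : skel (vkids x) = skel (vkids x') by rewrite !skel_vkids hls hk hl.
have hszk : size (vkids x) = size (vkids x') by rewrite -size_skel hsk size_skel.
have : A ++ vkids x ++ B = A' ++ vkids x' ++ B'.
  apply: IH hf _ _ _ hv.2.
  - by rewrite /skel !map_cat -!/(skel _) hsk /skel hA hB.
  - by rewrite /wf_forest !all_cat -!/(wf_forest _) wA wx wB.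
  - by rewrite /wf_forest !all_cat -!/(wf_forest _) wA' wx' wB'.
move=> /(cat_inj hsz)[-> /(cat_inj hszk)[hkids ->]]; congr (_ ++ _ :: _).
have : mkids x.2 = mkids x'.2 by rewrite -!map_snd_vkids hkids.
by case: x x' hk hl {hm hm' hf hst hv wx wx' sx sx' hls hsk hszk hkids IH}
  => k [i cs] [k' [i' cs']] /= -> -> ->.
Qed.

(** Decoding by induction on the total length of the streams: read one vector at the least pending
    key, decode the remainder, then gather the decoded children under a new vertex. *)
Lemma explores_surj (K : seq (vkey * 'I_d)) (s : 'I_d -> seq typevec) :
  extinction (type_count K) s -> exists L e,
  [/\ explores L e, skel L = K, wf_forest L & forall i, stream e i = s i].
Proof.
have [n] := ubnP (\sum_(i < d) size (s i)); elim: n K s => // n IH [|p0 K'] s hn hext.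
  exists [::], [::]; split=> // [|i]; first exact: explores_nil.
  by move/extinction0: hext => ->.
set K := p0 :: K' in hext.
have hm : min_idx (map fst K) < size K by rewrite -(size_map fst) min_idx_lt.
have [hK hsz] := split_nth p0 hm.
move: hsz hK; set KA := take _ _; set KB := drop _ _; case: (nth _ _ _) => k i hsz hK.
have ri : 0 < type_count K i.
  by rewrite hK /type_count count_cat /= eqxx addn_gt0 orbT.
(* The stream lengths themselves form a solution, so the stream of a pending type cannot be
   exhausted. *)
have := consumption_sol_gt0 hext.1 ri; case hsi: (s i) => [//|v si] _.
pose s' j := if j == i then si else s j.
have [ls [sls hls]] := sorted_types_exist v.
pose K1 := KA ++ kid_skel k i ls ++ KB.
have hs' j : j != i -> s j = s' j by rewrite /s' => /negbTE ->.
have hsi' : s i = v :: s' i by rewrite /s' eqxx.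
have [||L1 [e [he hL1 hw hst]]] := IH K1 s'.
- apply: leq_trans (_ : \sum_(j < d) size (s j) <= n); last by rewrite -ltnS.
  rewrite (bigD1 i) //= [in X in _ <= X](bigD1 i) //= hsi' /= addSn ltnS leq_add2l.
  by apply: leq_sum => j /hs' ->.
- apply: (iffLR (extinction_pop hsi' hs' _ ri) hext) => j.
  by rewrite hK; apply: type_count_pop.
(* The decoded list is cut at the lengths of the blocks of its skeleton; the middle block [C]
   consists of the children of the vertex to be rebuilt. *)
pose a := size KA; pose b := size (kid_skel k i ls).
pose A := take a L1; pose C := take b (drop a L1); pose B := drop b (drop a L1).
have eL1 : L1 = A ++ C ++ B by rewrite !cat_take_drop.
have [eA eCB] : skel A = KA /\ skel (C ++ B) = kid_skel k i ls ++ KB.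
  apply: cat_inj; last by rewrite -/K1 -hL1 eL1 /skel !map_cat.
  by rewrite size_map size_takel // -size_skel hL1 size_cat leq_addr.
have [eC eB] : skel C = kid_skel k i ls /\ skel B = KB.
  apply: cat_inj; last by rewrite -eCB /skel !map_cat.
  rewrite size_map size_takel // -size_skel -[drop _ _](cat_take_drop b).
  by rewrite eCB size_cat leq_addr.
pose t := MNode i (map snd C).
have hlab : map (@mlabel d) (map snd C) = ls.
  transitivity (map snd (skel C)); first by rewrite /skel -!map_comp.
  by rewrite eC -map_comp -[RHS]enumerate_snd; apply: eq_map.
(* The keys in [C] are those prescribed by [kid_skel], so keying the children of the new vertex
   gives back [C] itself. *)
have hC : vkids (k, t) = C.
  have : skel (vkids (k, t)) = skel C by rewrite skel_vkids /= hlab eC.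
  have : map snd (vkids (k, t)) = map snd C by rewrite map_snd_vkids.
  elim: (vkids _) (C) => [|[k1 t1] l IHl] [|[k2 t2] l2] //= [-> h] [-> h'].
  by rewrite (IHl l2).
have hsk : skel (A ++ (k, t) :: B) = K by rewrite /skel map_cat map_cons -!/(skel _) eA eB.
exists (A ++ (k, t) :: B), (t :: e); split=> //.
- apply: (@explores_cons A (k, t)); last by rewrite hC -eL1.
  by rewrite min_pos_skel hsk -hsz -eA size_map.
- move: hw; rewrite eL1 /wf_forest !all_cat -!/(wf_forest _) => /and3P[wA wC wB].
  have wt : mwf t by rewrite mwfE hlab sls /= all_map.
  by rewrite wA [wf_forest _](_ : _ = mwf t && wf_forest B) // wt wB.
- move=> j; rewrite stream_cons /= hst eq_sym; case: (eqVneq j i) => [->|/hs' //].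
  rewrite hsi'; congr (_ :: _); apply/ffunP => l; rewrite child_vecE /= hlab.
  exact: hls.
Qed.

End Exploration.

(** * Coding by integer families *)

Section Coding.

Variable d : nat.
Implicit Types (f : seq (mtree d)) (e : seq (mtree d)) (s : 'I_d -> seq (typevec d)).

Definition family_of s : seqfam d :=
  [ffun i => [seq [ffun j => (\sum_(v <- take n (s i)) ((v j)%:Z - (j == i)%:Z))%R]
             | n <- iota 0 (size (s i)).+1]].

Lemma xlen_family s i : xlen (family_of s) i = size (s i).
Proof. by rewrite /xlen ffunE size_map size_iota. Qed.

Lemma xval_family s i n j : n <= size (s i) ->
  xval (family_of s) i n j = (\sum_(v <- take n (s i)) ((v j)%:Z - (j == i)%:Z))%R.
Proof. by move=> h; rewrite /xval ffunE (nth_map 0) ?size_iota // nth_iota // ffunE. Qed.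

Lemma xval_family0 s i j : xval (family_of s) i 0 j = 0%R.
Proof. by rewrite xval_family // take0 big_nil. Qed.

Lemma xval_familyS s i n j : n < size (s i) -> xval (family_of s) i n.+1 j =
  (xval (family_of s) i n j + ((nth [ffun=> 0] (s i) n j)%:Z - (j == i)%:Z))%R.
Proof.
move=> h; rewrite !xval_family //; last exact: ltnW.
by rewrite (take_nth [ffun=> 0]) // -cats1 big_cat big_seq1.
Qed.

Lemma family_of_inj s s' : family_of s = family_of s' -> forall i, s i = s' i.
Proof.
move=> h i; have hsz : size (s i) = size (s' i) by rewrite -!xlen_family h.
apply: (@eq_from_nth _ [ffun=> 0]) => // n hn; apply/ffunP => j.
have := xval_familyS j hn; rewrite h xval_familyS -?hsz //.
by move=> /GRing.addrI /GRing.addIr [->].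
Qed.

Lemma in_Sd_family s : in_Sd (family_of s).
Proof.
move=> i; split; first by rewrite ffunE size_map.
split=> [j|n]; first exact: xval_family0.
rewrite xlen_family => hn j; rewrite !xval_familyS // eqxx.
by split=> [/negbTE ->|_]; lia.
Qed.

(** The increments of [x], raised by one on the diagonal, are nonnegative by [in_Sd]; [absz]
    therefore leaves their values unchanged. *)
Lemma family_of_surj (x : seqfam d) : in_Sd x -> exists s, x = family_of s.
Proof.
move=> hx; pose s i : seq (typevec d) :=
  [seq [ffun j => absz (xval x i n.+1 j - xval x i n j + (j == i)%:Z)%R] | n <- iota 0 (xlen x i)].
have hs i : size (s i) = xlen x i by rewrite size_map size_iota.
exists s; apply/ffunP => i; have [h0 [x0 hinc]] := hx i.
have hsz : size (x i) = (xlen x i).+1 by rewrite prednK.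
apply: (@eq_from_nth _ [ffun=> 0%R]).
  by rewrite ffunE size_map size_iota hs hsz.
move=> n; rewrite hsz ltnS => hn; apply/ffunP => j.
rewrite -/(xval x i n j) -/(xval (family_of s) i n j).
elim: n hn => [|n IH] hn; first by rewrite xval_family0 x0.
rewrite xval_familyS ?hs // -IH ?(ltnW hn) // (nth_map 0) ?size_iota // ffunE nth_iota //= add0n.
have [h1 h2] := hinc n hn j; case: (eqVneq j i) => [eji|hji] /=.
  by have := h2 eji; rewrite eji; lia.
by have := h1 hji; lia.
Qed.

Lemma consumption_sol_ext (r r' : 'I_d -> nat) s s' (n n' : 'I_d -> nat) :
  r =1 r' -> s =1 s' -> n =1 n' -> consumption_sol r s n -> consumption_sol r' s' n'.
Proof.
move=> hr hs hn [h1 h2]; split=> [i|j]; first by rewrite -hs -hn.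
by rewrite -hn h2 hr; congr (_ + _); apply: eq_bigr => i _; rewrite hs hn.
Qed.

Lemma extinction_ext (r r' : 'I_d -> nat) s s' :
  r =1 r' -> s =1 s' -> extinction r s -> extinction r' s'.
Proof.
move=> hr hs [h1 h2]; split=> [|n hn i].
  by apply: consumption_sol_ext h1 => // i; rewrite hs.
by rewrite -hs; apply: (h2 n); apply: consumption_sol_ext hn.
Qed.

Lemma is_solution_family (r : 'I_d -> nat) s n :
  is_solution r (family_of s) n <-> consumption_sol r s n.
Proof.
(* The bound on [n], part of both notions, comes first: beyond the end of a sequence [xval] would
   read the default zero. *)
suff H : (forall i, n i <= size (s i)) -> forall j,
    ((r j)%:Z + \sum_(i < d) xval (family_of s) i (n i) j = 0 <->
     n j = (r j + \sum_(i < d) \sum_(v <- take (n i) (s i)) v j)%N)%R.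
  split=> -[h1 h2].
    have hn i : n i <= size (s i) by rewrite -xlen_family.
    by split=> // j; apply: (iffLR (H hn j)).
  by split=> [i|j]; [rewrite xlen_family | apply: (iffRL (H h1 j))].
move=> hn j.
have -> : (\sum_(i < d) xval (family_of s) i (n i) j =
    (\sum_(i < d) \sum_(v <- take (n i) (s i)) v j)%N%:Z - (n j)%:Z)%R.
  (* The unit decrements among the first [n i] entries sum to [n i] on the diagonal and to zero
     elsewhere; over all [i] they add up to [n j]. *)
  rewrite (eq_bigr (fun i => ((\sum_(v <- take (n i) (s i)) v j)%N%:Z - (n i * (j == i))%N%:Z)%R)).
    rewrite GRing.sumrB -!(big_morph Posz PoszD (erefl _)); congr (_ - Posz _)%R.
    rewrite (bigD1 j) //= eqxx muln1 big1 ?addn0 // => i.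
    by rewrite eq_sym => /negbTE ->; rewrite muln0.
  move=> i _; rewrite xval_family // GRing.sumrB -!(big_morph Posz PoszD (erefl _)).
  by rewrite big_const_seq count_predT size_takel // iter_addn_0 mulnC.
lia.
Qed.

Lemma in_Sdr_family (r : 'I_d -> nat) s :
  in_Sdr r (family_of s) <-> (forall i, 0 < size (s i)) /\ extinction r s.
Proof.
have hx := xlen_family s.
split=> [[_ [hpos [hsol hmin]]]|[hpos [hsol hmin]]]; split.
- by move=> i; rewrite -hx.
- split; first by apply: consumption_sol_ext (iffLR (is_solution_family _ _ _) hsol).
  by move=> n /is_solution_family /hmin h i; rewrite -hx.
- exact: in_Sd_family.
- split=> [i|]; first by rewrite hx.
  split; first by apply/is_solution_family; apply: consumption_sol_ext hsol => // i; rewrite hx.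
  by move=> n /is_solution_family /hmin h i; rewrite hx.
Qed.

(** * Reading [Psi] and the root types off the exploration of a forest *)

Lemma explores_forest f e :
  explores (keyed_forest f) e -> map snd (explore_order f) = e.
Proof.
move=> he; apply: (explores_sorted he _ (pairwise_explore_order f) (perm_explore_order f)).
by apply/allP => x /keyed_forestP[].
Qed.

Lemma explore_order_explores f : explores (keyed_forest f) (map snd (explore_order f)).
Proof.
by have [e he] := explores_total (keyed_forest f); rewrite (explores_forest he).
Qed.

Lemma Psi_explore f : Psi f = family_of (stream (map snd (explore_order f))).
Proof.
apply/ffunP => i; rewrite !ffunE subforest_vertices_keyed /stream size_map.
apply: eq_map => n; apply/ffunP => j; rewrite !ffunE -map_take big_map.
by apply: eq_bigr => u _; rewrite !ffunE.
Qed.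

(** This links the positive length of each sequence with the presence of every type in the
    forest. *)
Lemma size_stream_explore f i :
  size (stream (map snd (explore_order f)) i) = count (fun w => mlabel w.1 == i) (forest_bfs f).
Proof.
rewrite /stream size_map size_filter count_map forest_bfs_keyed count_map.
exact: (permP (perm_explore_order f)).
Qed.

Definition root_skel (c : seq 'I_d) : seq (vkey * 'I_d) :=
  [seq (root_key p.1, p.2) | p <- enumerate c].

Lemma skel_keyed_forest f : skel (keyed_forest f) = root_skel (root_types f).
Proof. by rewrite /root_skel /root_types enumerate_map /skel -!map_comp; apply: eq_map. Qed.

Lemma type_count_root_skel c j : type_count (root_skel c) j = count_mem j c.
Proof. by rewrite -[in RHS](enumerate_snd c) /type_count !count_map; apply: eq_count. Qed.

Lemma map_snd_keyed_forest f : map snd (keyed_forest f) = f.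
Proof. by rewrite -map_comp -[RHS]enumerate_snd; apply: eq_map. Qed.

Lemma wf_keyed_forest f : wf_forest (keyed_forest f) = all (@mwf d) f.
Proof. by rewrite -[in RHS](map_snd_keyed_forest f) all_map. Qed.

Lemma pair_seq_inj (S T : Type) (s s' : seq (S * T)) :
  map fst s = map fst s' -> map snd s = map snd s' -> s = s'.
Proof. by elim: s s' => [|[a b] s IH] [|[a' b'] s'] //= [-> h] [-> /(IH _ h) ->]. Qed.

Lemma root_types_skel (L : seq (kvert d)) c : skel L = root_skel c ->
  root_types (map snd L) = c.
Proof.
move=> h; transitivity (map snd (skel L)); first by rewrite /skel /root_types -!map_comp.
by rewrite h -map_comp -[RHS]enumerate_snd; apply: eq_map.
Qed.

(** Decoding yields a list of keyed vertices; if its skeleton is that of roots, its keys are the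
    root keys, so it comes from an actual forest. *)
Lemma keyed_forest_skel (L : seq (kvert d)) c : skel L = root_skel c ->
  keyed_forest (map snd L) = L.
Proof.
move=> h; have hc := root_types_skel h.
apply: pair_seq_inj; last exact: map_snd_keyed_forest.
have : map fst (skel (keyed_forest (map snd L))) = map fst (skel L).
  by rewrite skel_keyed_forest hc h.
by rewrite /skel -!map_comp.
Qed.

End Coding.

Theorem theorem2p7 (d : nat) (r : 'I_d -> nat) :
  (2 <= d)%N -> (exists i, 0 < r i)%N ->
  (forall f, in_Fdr r f -> in_Sdr r (Phi f).1 /\ in_Cdr r (Phi f).2) /\
  (forall f g, in_Fdr r f -> in_Fdr r g -> Phi f = Phi g -> f = g) /\
  (forall x c, in_Sdr r x -> in_Cdr r c -> exists f, in_Fdr r f /\ Phi f = (x, c)).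
Proof.
move=> _ _; split=> [f [_ [_ [hall hC]]]|]; last split.
- split=> //=; rewrite Psi_explore; apply/in_Sdr_family; split=> [i|].
    by rewrite size_stream_explore -has_count.
  apply: extinction_ext (explores_extinction (explore_order_explores f)) => // j.
  by rewrite skel_keyed_forest type_count_root_skel hC.2.
- move=> f g [wf _] [wg _] [hPsi hroots].
  rewrite -[LHS]map_snd_keyed_forest -[RHS]map_snd_keyed_forest; congr map.
  apply: (explores_inj (explore_order_explores f) (explore_order_explores g));
    rewrite ?wf_keyed_forest ?skel_keyed_forest ?hroots //.
  by apply: family_of_inj; rewrite -!Psi_explore.
- move=> x c hx hc; have [s hs] := family_of_surj hx.1.
  move: hx; rewrite hs => /in_Sdr_family[hpos hext].
  have [|L [e [he hL wL hst]]] := @explores_surj _ (root_skel c) s.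
    by apply: extinction_ext hext => // j; rewrite type_count_root_skel hc.2.
  pose f := map snd L.
  have hf : keyed_forest f = L by apply: keyed_forest_skel hL.
  have hr : root_types f = c by apply: root_types_skel hL.
  (* The decoded visiting sequence [e] is the exploration order of [f], since an exploration of a
     keyed forest can only give that order. *)
  have hse i : stream (map snd (explore_order f)) i = s i.
    by rewrite -hst; congr (stream _ i); apply: explores_forest; rewrite hf.
  exists f; split; last first.
    rewrite /Phi hr Psi_explore; congr (_, _); apply/ffunP => i; rewrite !ffunE hse.
    by [].
  split; first by rewrite -wf_keyed_forest hf.
  split; first by rewrite -hc.1 -hr [RHS]size_map.
  split=> [i|]; last by rewrite hr.
  by rewrite has_count -size_stream_explore hse.
Qed.
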